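(* If a digraph $G$ admits an oriented near $\alpha$-valuation, then for every positive integer $l$ its lexicographic product $G\cdot K_l^c$ admits an oriented near $\alpha$-valuation.
   Context: Digraphs are oriented graphs. For a digraph $G$, $G\cdot K_l^c$ is the digraph with vertex set $V(G)\times\{1,\ldots,l\}$ and an arc from $(x,i)$ to $(y,j)$ exactly when $(x,y)$ is an arc of $G$. For a digraph with $n$ arcs, an oriented $\beta$-valuation is an injective $b:V\to\{0,\ldots,n\}$ such that the multiset $\{b(v)-b(u)\bmod (n+1):(u,v)\text{ an arc}\}$ equals $\mathbb{Z}_{n+1}\setminus\{0\}$. An oriented near $\alpha$-valuation is an oriented $\beta$-valuation $b$ with a partition $V=V_{small}\cup V_{large}$ such that each $v\in V_{small}$ has $b(v)<b(u)$ for all $u$ adjacent to $v$ in the underlying undirected graph, and each $v\in V_{large}$ has $b(v)>b(u)$ for all such $u$.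
   Formalization: The digraph G is assumed to have at least one arc; without this the claim fails for a single vertex with no arcs, since its product with K_2^c has two vertices and no arcs and so admits no injective labelling into {0}. *)

(* Defs.v *)
From mathcomp Require Import all_boot all_algebra.

Set Implicit Arguments.
Unset Strict Implicit.
Unset Printing Implicit Defensive.

(* Digraphs are finite oriented graphs: asymmetry of the arc relation rules out
   both loops (take x = y) and pairs of opposite arcs. *)
Record digraph := Digraph {
  vertex :> finType;
  arc_rel : rel vertex;
  arc_asym : forall x y, arc_rel x y -> ~~ arc_rel y x
}.

Definition arcs (G : digraph) : {set G * G} := [set a | arc_rel a.1 a.2].

Definition num_arcs (G : digraph) : nat := #|arcs G|.

Definition adjacent (G : digraph) : rel G := fun x y => arc_rel x y || arc_rel y x.

Section LexProduct.
Variables (G : digraph) (l : nat).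

Definition lex_arc : rel (G * 'I_l)%type := fun p q => arc_rel p.1 q.1.

Lemma lex_arc_asym p q : lex_arc p q -> ~~ lex_arc q p.
Proof. exact: arc_asym. Qed.

(* The product G . K_l^c; the second coordinate ranges over {0, ..., l-1}
   instead of {1, ..., l}. *)
Definition lex_product_empty : digraph := Digraph lex_arc_asym.

End LexProduct.

(* The codomain {0, ..., n} is 'I_n.+1, whose canonical Z-module structure is
   the additive group Z_{n+1}, so that b v - b u below is the residue of the
   difference modulo n + 1.  Multisets are sequences up to perm_eq. *)
Definition oriented_beta_valuation (G : digraph)
    (b : G -> 'I_(num_arcs G).+1) : Prop :=
  injective b /\
  perm_eq [seq (b a.2 - b a.1)%R | a in arcs G]
          (enum [set k : 'I_(num_arcs G).+1 | k != 0%R]).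

(* The inequalities between labels compare them as natural numbers; V_small and
   V_large may be empty. *)
Definition oriented_near_alpha_valuation (G : digraph)
    (b : G -> 'I_(num_arcs G).+1) : Prop :=
  oriented_beta_valuation b /\
  exists Vsmall Vlarge : {set G},
    [/\ Vsmall :|: Vlarge = [set: G],
        [disjoint Vsmall & Vlarge],
        forall v, v \in Vsmall -> forall u, adjacent v u -> b v < b u
      & forall v, v \in Vlarge -> forall u, adjacent v u -> b u < b v].

Definition admits_oriented_near_alpha_valuation (G : digraph) : Prop :=
  exists b : G -> 'I_(num_arcs G).+1, oriented_near_alpha_valuation b.

(* Main.v *)
(** Put [L = l ^ 2].  A small vertex [(x, i)] gets the label [L * b x + l * i],
    a large one [(y, j)] gets [L * b y - j].  If an arc [(x, y)] has residue [r]
    modulo [n + 1], the [L] arcs above it then have as residues modulo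
    [n * L + 1] exactly the block [L * (r - 1) + 1, ..., L * r], whichever end
    of the arc is small; the blocks of distinct residues are disjoint.
    Isolated vertices may lie on either side, so those labelled [0] have to be
    made small and those labelled [n] large for the new labels to stay within
    [0, ..., n * L]. *)
Require Import Defs.
From mathcomp Require Import all_boot all_algebra.
From mathcomp Require Import zify.

Set Implicit Arguments.
Unset Strict Implicit.
Unset Printing Implicit Defensive.

(** * Differences modulo [n + 1] and digits in base [l] *)

Lemma val_ord_sub_le n (a c : 'I_n.+1) : a <= c -> (c - a)%R = c - a :> nat.
Proof.
move=> ac; have cn := ltn_ord c.
by rewrite /= modnDmr addnBA 1?ltnW // addnC -addnBA // modnDl modn_small //; lia.
Qed.

Lemma val_ord_sub_gt n (a c : 'I_n.+1) : c < a -> (c - a)%R = n.+1 - (a - c) :> nat.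
Proof.
move=> ca; have an := ltn_ord a.
by rewrite /= modnDmr modn_small; lia.
Qed.

Lemma base_repr_inj l i j i' j' :
  j < l -> j' < l -> l * i + j = l * i' + j' -> i = i' /\ j = j'.
Proof.
move=> jl j'l; rewrite ![l * _]mulnC => e.
have l0 : 0 < l by apply: leq_ltn_trans jl.
split.
  by have := congr1 (divn^~ l) e; rewrite !divnMDl // !divn_small // !addn0.
by have := congr1 (modn^~ l) e; rewrite !modnMDl !modn_small.
Qed.

Lemma base_repr_lt l i j : i < l -> j < l -> l * i + j < l * l.
Proof.
move=> il jl; apply: (@leq_trans (l * i.+1)); first by rewrite mulnS; lia.
by rewrite leq_mul2l il orbT.
Qed.

(** Both equations say that [r] is [D / L] rounded up and that [k] is the distance from [D] up to
    [L * r]. *)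
Lemma block_inj L D k k' r r' :
  k < L -> k' < L -> D + k = L * r -> D + k' = L * r' -> r = r' /\ k = k'.
Proof.
move=> kL k'L e e'.
suff er : r = r' by subst r'; split=> //; lia.
have ltS (s t : nat) : s < t -> L * s + L <= L * t.
  by move=> st; rewrite -mulnSr leq_mul2l st orbT.
by case: (ltngtP r r') => [/ltS | /ltS | //]; lia.
Qed.

(** * Counting arcs and nonzero residues *)

Lemma card_lex_arcs (G : digraph) l :
  num_arcs (lex_product_empty G l) = num_arcs G * (l * l).
Proof.
pose f (t : (G * G) * ('I_l * 'I_l)) : (G * 'I_l) * (G * 'I_l) :=
  ((t.1.1, t.2.1), (t.1.2, t.2.2)).
have f_inj : injective f by move=> [[x y] [i j]] [[x' y'] [i' j']] [-> -> -> ->].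
have -> : l * l = #|[set: 'I_l * 'I_l]| by rewrite cardsT card_prod card_ord.
rewrite /num_arcs -cardsX -(card_imset _ f_inj); apply: eq_card => [[[x i] [y j]]].
rewrite inE; apply/idP/imsetP => [xy | [[[x' y'] [i' j']]]].
  by exists ((x, y), (i, j)); rewrite // !inE andbT.
by rewrite !inE andbT => xy [-> _ -> _].
Qed.

(** By counting, [n] distinct nonzero residues exhaust the nonzero part of the integers modulo
    [n + 1]. *)
Lemma perm_eq_image_nonzero (T : finType) (A : {set T}) n (f : T -> 'I_n.+1) :
  #|A| = n -> {in A &, injective f} -> {in A, forall a, f a != 0%R} ->
  perm_eq [seq f a | a in A] (enum [set k : 'I_n.+1 | k != 0%R]).
Proof.
move=> cA f_inj f_nz.
have u : uniq [seq f a | a in A].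
  rewrite map_inj_in_uniq ?enum_uniq // => a c.
  by rewrite !mem_enum; apply: f_inj.
have sub : {subset [seq f a | a in A] <= enum [set k : 'I_n.+1 | k != 0%R]}.
  by move=> k /imageP [a aA ->]; rewrite mem_enum inE f_nz.
have card_nz : #|[set k : 'I_n.+1 | k != 0%R]| = n.
  have -> : [set k : 'I_n.+1 | k != 0%R] = [set~ 0%R] by apply/setP=> k; rewrite !inE.
  by rewrite cardsC1 card_ord.
have sz : size (enum [set k : 'I_n.+1 | k != 0%R]) <= size [seq f a | a in A].
  by rewrite size_image -cardE cA card_nz.
have [_ eqm] := uniq_min_size u sub sz.
by apply: uniq_perm; rewrite ?enum_uniq.
Qed.

Lemma beta_arc_diff_inj (G : digraph) (b : G -> 'I_(num_arcs G).+1) :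
  oriented_beta_valuation b ->
  {in arcs G &, injective (fun a => (b a.2 - b a.1)%R)}.
Proof.
case=> _ /perm_uniq; rewrite enum_uniq => /dinjectiveP diff_inj a c aG cG.
exact: diff_inj.
Qed.

Lemma beta_arc_diff_neq0 (G : digraph) (b : G -> 'I_(num_arcs G).+1) (a : G * G) :
  oriented_beta_valuation b -> a \in arcs G -> (b a.2 - b a.1)%R != 0%R.
Proof.
case=> _ /perm_mem eqm aG; have := eqm (b a.2 - b a.1)%R.
rewrite mem_enum inE => <-; exact: image_f.
Qed.

Lemma near_alpha_split (G : digraph) (b : G -> 'I_(num_arcs G).+1) :
  0 < num_arcs G -> oriented_near_alpha_valuation b ->
  exists small : pred G,
    [/\ forall x, small x -> b x < num_arcs G,
        forall x, ~~ small x -> 0 < b x,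
        forall x y, adjacent x y -> small x -> b x < b y
      & forall x y, adjacent x y -> ~~ small x -> b y < b x].
Proof.
move=> n0 [_ [S [T [cov _ sm lg]]]].
(* Only isolated vertices change side: a neighbour of a vertex of [T] labelled 0 would need a label
   below 0, and a neighbour of a vertex of [S] labelled [num_arcs G] one above it. *)
exists (fun x => ((x \in S) && (b x != num_arcs G :> nat)) || (b x == 0 :> nat)).
have inST x : (x \in S) || (x \in T) by rewrite -in_setU cov inE.
split=> x.
- by case/orP=> [/andP [_]|/eqP ->//]; have := ltn_ord (b x); lia.
- by rewrite negb_or lt0n => /andP [].
- move=> y xy /orP [/andP [xS _]|/eqP b0]; first exact: sm xS _ xy.
  case/orP: (inST x) => [xS|xT]; first exact: sm xS _ xy.
  by have := lg x xT y xy; rewrite b0.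
- move=> y xy; rewrite negb_or negb_and negbK => /andP [xST _].
  case/orP: (inST x) => [xS|xT]; last exact: lg xT _ xy.
  have := sm x xS y xy; move: xST; rewrite xS /= => /eqP ->.
  by have := ltn_ord (b y); lia.
Qed.

(** * The labelling of the product *)

Section LexLabel.

Variables (G : digraph) (l : nat) (b : G -> 'I_(num_arcs G).+1) (small : pred G).
Hypotheses (small_lt : forall x, small x -> b x < num_arcs G)
  (large_gt : forall x, ~~ small x -> 0 < b x)
  (small_adj : forall x y, adjacent x y -> small x -> b x < b y)
  (large_adj : forall x y, adjacent x y -> ~~ small x -> b y < b x)
  (b_beta : oriented_beta_valuation b).

Local Notation n := (num_arcs G).
Local Notation H := (lex_product_empty G l).

Definition lex_label_nat (p : H) : nat :=
  if small p.1 then l * l * b p.1 + l * p.2 else l * l * b p.1 - p.2.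

Definition lex_label (p : H) : 'I_(num_arcs H).+1 := inord (lex_label_nat p).

Lemma ord_lt_sqr (i : 'I_l) : i < l * l.
Proof. by apply: leq_trans (ltn_ord i) _; rewrite leq_pmulr // (leq_ltn_trans _ (ltn_ord i)). Qed.

Lemma sqr_block_le (s t : nat) : s < t -> l * l * s + l * l <= l * l * t.
Proof. by move=> st; rewrite -mulnSr leq_mul2l st orbT. Qed.

Lemma lex_label_nat_le p : lex_label_nat p <= num_arcs H.
Proof.
rewrite card_lex_arcs [n * _]mulnC /lex_label_nat; case: p => x i /=.
case: ifP => [/small_lt xn | _].
  apply: leq_trans (sqr_block_le xn); rewrite leq_add2l leq_mul2l.
  by rewrite [i <= l]ltnW ?orbT.
by apply: leq_trans (leq_subr _ _) _; rewrite leq_mul2l -ltnS ltn_ord orbT.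
Qed.

Lemma val_lex_label p : lex_label p = lex_label_nat p :> nat.
Proof. by rewrite inordK // ltnS lex_label_nat_le. Qed.

(** A large vertex has [b p.1 >= 1], so [l * l * b p.1] exceeds [p.2] and the subtraction is not
    truncated. *)
Lemma lex_label_large (p : H) :
  ~~ small p.1 -> lex_label_nat p + p.2 = l * l * b p.1.
Proof.
move=> lg; rewrite /lex_label_nat (negbTE lg) subnK //.
apply: leq_trans (ltnW (ord_lt_sqr p.2)) _.
by rewrite leq_pmulr // large_gt.
Qed.

Lemma lex_label_small (p : H) :
  small p.1 -> lex_label_nat p = l * l * b p.1 + l * p.2.
Proof. by rewrite /lex_label_nat => ->. Qed.

(* A large label [L * (c + 1) - j] exceeds [L * c + l * (l - 1)], the largest
   small label in the same block of length [L]. *)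
Lemma lex_label_small_large (p q : H) :
  small p.1 -> ~~ small q.1 -> lex_label_nat p != lex_label_nat q.
Proof.
move=> sp lq; apply/eqP=> e.
have eq_q := lex_label_large lq; have eq_p := lex_label_small sp.
have ip : l * p.2 + q.2 < l * l by apply: base_repr_lt.
(* Two multiples of [l * l] that differ by less than [l * l] coincide, so [p.1] and [q.1] are the
   same vertex, which cannot lie on both sides. *)
have e' : l * l * b p.1 + (l * p.2 + q.2) = l * l * b q.1 by lia.
have neq : b p.1 = b q.1 :> nat.
  case: (ltngtP (b p.1) (b q.1)) => // /sqr_block_le; lia.
have /val_inj /(proj1 b_beta) epq : val (b p.1) = val (b q.1) by [].
by rewrite -epq sp in lq.
Qed.

Lemma lex_label_inj : injective lex_label.
Proof.
move=> p q /(congr1 val) /=; rewrite !val_lex_label => e.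
suff [eb ei] : b p.1 = b q.1 :> nat /\ p.2 = q.2 :> nat.
  case: p q {e} eb ei => [x i] [y j] /= eb ei.
  by congr (_, _); [apply: (proj1 b_beta) | ]; apply: val_inj.
have [ip iq] := (ord_lt_sqr p.2, ord_lt_sqr q.2).
case sp: (small p.1); case sq: (small q.1).
- rewrite !lex_label_small // in e.
  have lt (i : 'I_l) : l * i < l * l.
    by rewrite ltn_mul2l ltn_ord andbT (leq_ltn_trans _ (ltn_ord i)).
  have [eb eli] := base_repr_inj (lt p.2) (lt q.2) e; split=> //.
  have l0 : 0 < l := leq_ltn_trans (leq0n _) (ltn_ord p.2).
  by apply/eqP; rewrite -(eqn_pmul2l l0) eli.
- by have := lex_label_small_large sp (negbT sq); rewrite e eqxx.
- by have := lex_label_small_large sq (negbT sp); rewrite e eqxx.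
- have ep := lex_label_large (negbT sp); have eq := lex_label_large (negbT sq).
  by rewrite e in ep; apply: block_inj ep eq.
Qed.

(** * Order and residues along the arcs of the product *)

Lemma adjacent_sides x y : adjacent x y -> small y = ~~ small x.
Proof.
move=> xy; have yx : adjacent y x by rewrite /adjacent orbC.
case sx: (small x); case sy: (small y) => //=.
  by have := small_adj xy sx; have := small_adj yx sy; lia.
by have := large_adj xy (negbT sx); have := large_adj yx (negbT sy); lia.
Qed.

Lemma lex_label_adj (p q : H) :
  adjacent p q -> small p.1 -> lex_label_nat p < lex_label_nat q.
Proof.
move=> pq sp; have xy : adjacent p.1 q.1 by [].
have lq : ~~ small q.1 by rewrite (adjacent_sides xy) sp.
have := base_repr_lt (ltn_ord p.2) (ltn_ord q.2).
have := sqr_block_le (small_adj xy sp).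
by have := lex_label_small sp; have := lex_label_large lq; lia.
Qed.

(** The position of an arc in its block, counted down from the top [l * l * r]. The two digits in
    base [l] are the second coordinates, that of the small end leading. *)
Definition block_offset (p q : H) : nat :=
  if small p.1 then l * p.2 + q.2 else (l * l).-1 - (l * q.2 + p.2).

Lemma block_offset_lt p q : block_offset p q < l * l.
Proof.
rewrite /block_offset; have l0 := leq_ltn_trans (leq0n _) (ord_lt_sqr p.2).
by case: ifP => _; [apply: base_repr_lt | lia].
Qed.

(** The labels of [p] and [q] are ordered as those of [p.1] and [q.1], so both differences wrap
    around or neither does. *)
Lemma lex_label_diff (p q : H) : arc_rel p q ->
  (lex_label q - lex_label p)%R + block_offset p q
    = l * l * (b q.1 - b p.1)%R :> nat.
Proof.
move=> pq; have adj : adjacent p q by rewrite /adjacent pq.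
have adjs : adjacent q p by rewrite /adjacent orbC.
have xy : adjacent p.1 q.1 by [].
have cardH : num_arcs H = l * l * n by rewrite card_lex_arcs mulnC.
rewrite /block_offset; case sp: (small p.1).
  have lq : ~~ small q.1 by rewrite (adjacent_sides xy) sp.
  have lt := lex_label_adj adj sp; have ltb := small_adj xy sp.
  rewrite !val_ord_sub_le ?val_lex_label ?(ltnW ltb) ?(ltnW lt) //.
  have := lex_label_small sp; have := lex_label_large lq.
  by rewrite mulnBr; lia.
have sq : small q.1 by rewrite (adjacent_sides xy) sp.
have lt := lex_label_adj adjs sq; have ltb := large_adj xy (negbT sp).
(* With [L = l * l], the moduli satisfy [L * n + 1 = L * (n + 1) - (L - 1)]; this accounts for the
   complement to [L - 1] in the offset. *)
rewrite !val_ord_sub_gt ?val_lex_label //.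
have ep := lex_label_large (negbT sp); have eq := lex_label_small sq.
have off := base_repr_lt (ltn_ord q.2) (ltn_ord p.2).
have le_p := lex_label_nat_le p.
have bn : l * l * b p.1 <= l * l * n by rewrite leq_mul2l -ltnS ltn_ord orbT.
by rewrite !mulnBr mulnS; lia.
Qed.

(** Equal residues share a block, hence the arc of [G], and an offset, whose digits give the second
    coordinates. A residue is nonzero because [r >= 1] and the offset is below [l * l]. *)
Lemma lex_label_beta : oriented_beta_valuation lex_label.
Proof.
split; first exact: lex_label_inj.
apply: perm_eq_image_nonzero => // [[p q] [p' q'] | [p q]]; rewrite !inE /=.
  move=> pq pq' e.
  have d := lex_label_diff pq; rewrite e in d.
  have [/val_inj er ek] := block_inj (block_offset_lt p q) (block_offset_lt p' q')
    d (lex_label_diff pq').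
  have [ex ey] : (p.1, q.1) = (p'.1, q'.1).
    by apply: (beta_arc_diff_inj b_beta); rewrite ?inE.
  suff [ei ej] : p.2 = p'.2 :> nat /\ q.2 = q'.2 :> nat.
    case: p q p' q' ex ey ei ej {pq pq' e d er ek} => [x i] [y j] [x' i'] [y' j'] /=.
    by move=> -> -> /val_inj -> /val_inj ->.
  (* Since [p.1 = p'.1], both offsets are given by the same branch. *)
  move: ek; rewrite /block_offset -ex.
  have := base_repr_lt (ltn_ord q.2) (ltn_ord p.2).
  have := base_repr_lt (ltn_ord q'.2) (ltn_ord p'.2).
  case: ifP => _ lt' lt ek; first exact: base_repr_inj ek.
  have ek' : l * q.2 + p.2 = l * q'.2 + p'.2 by lia.
  by have [] := base_repr_inj (ltn_ord _) (ltn_ord _) ek'.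
move=> pq; have d := lex_label_diff pq; have k_lt := block_offset_lt p q.
have r_nz : (b q.1 - b p.1)%R != 0%R.
  by apply: (beta_arc_diff_neq0 (a := (p.1, q.1)) b_beta); rewrite inE.
have r_gt : 0 < (b q.1 - b p.1)%R by rewrite lt0n.
have L_le : l * l <= l * l * (b q.1 - b p.1)%R by rewrite leq_pmulr.
apply/eqP=> D0; rewrite D0 in d; have {}d : block_offset p q = _ := d.
by move: k_lt; rewrite d ltnNge L_le.
Qed.

Lemma lex_label_near_alpha : oriented_near_alpha_valuation lex_label.
Proof.
split; first exact: lex_label_beta.
exists [set p : H | small p.1], [set p : H | ~~ small p.1]; split.
- by apply/setP=> p; rewrite !inE orbN.
- by rewrite -setI_eq0; apply/eqP/setP=> p; rewrite !inE andbN.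
- by move=> p; rewrite inE => sp q pq; rewrite !val_lex_label lex_label_adj.
- move=> p; rewrite inE => lp q pq; rewrite !val_lex_label lex_label_adj //.
    by rewrite /adjacent orbC.
  by rewrite (@adjacent_sides p.1 q.1).
Qed.

End LexLabel.

Theorem theorem5p17 (G : digraph) (hG : 0 < num_arcs G) (l : nat) (hl : 0 < l) :
  admits_oriented_near_alpha_valuation G ->
  admits_oriented_near_alpha_valuation (lex_product_empty G l).
Proof.
case=> b b_alpha; have [small [sm lg sm_adj lg_adj]] := near_alpha_split hG b_alpha.
exists (lex_label b small); exact: lex_label_near_alpha sm lg sm_adj lg_adj (proj1 b_alpha).
Qed.
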